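(* Let $p$ be an odd prime and $n$ an integer with $\gcd(n,p)=1$. Then $$\sum_{\chi \bmod p}|G(n,\chi;p)|^6=\begin{cases}10p^4+O(p^{7/2}), & p\equiv 1\pmod 4,\\ (p-1)(10p^3-25p^2-4p-1), & p\equiv 3\pmod 4,\end{cases}$$ where the sum is over all Dirichlet characters modulo $p$ and the implied constant is absolute.
   Context: For a prime $p$, an integer $n$ and a Dirichlet character $\chi$ modulo $p$, the generalized quadratic Gauss sum is $G(n,\chi;p)=\sum_{a=1}^{p}\chi(a)e\!\left(\frac{na^2}{p}\right)$ with $e(y)=e^{2\pi i y}$. *)

(* Defs.v *)
From mathcomp Require Import all_boot all_order all_algebra.
From mathcomp Require Import all_classical all_reals all_analysis.
From mathcomp Require Export complex.
Set Implicit Arguments. Unset Strict Implicit. Unset Printing Implicit Defensive.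
Import Order.TTheory GRing.Theory Num.Theory.
Local Open Scope ring_scope.
Local Open Scope complex_scope.

Section Defs.
Variable R : realType.

Definition e_ (y : R) : R[i] := (cos (2 * pi * y)) +i* (sin (2 * pi * y)).

Definition is_dirichlet_char (q : nat) (chi : nat -> R[i]) : Prop :=
  [/\ forall a, chi (a + q)%N = chi a,
      forall a b, chi (a * b)%N = chi a * chi b,
      chi 1%N = 1 &
      forall a, (chi a == 0) = ~~ coprime a q].

Definition dirichlet_chars (q : nat) : set (nat -> R[i]) :=
  [set chi | is_dirichlet_char q chi].

Definition gauss_gen (n : int) (chi : nat -> R[i]) (p : nat) : R[i] :=
  \sum_(1 <= a < p.+1) chi a * e_ (n%:~R * (a%:R) ^+ 2 / p%:R).

Definition sixth_moment (n : int) (p : nat) : R[i] :=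
  (\sum_(chi \in dirichlet_chars p) `|gauss_gen n chi p| ^+ 6)%R.

End Defs.

(* Main.v *)
Require Import Defs.
From mathcomp Require Import all_boot all_order all_algebra.
From mathcomp Require Import cyclic finfield.
From mathcomp Require Import all_classical all_reals all_analysis.
From mathcomp Require Import complex.
From mathcomp Require Import ring lra zify.
Set Implicit Arguments. Unset Strict Implicit. Unset Printing Implicit Defensive.
Import Order.TTheory GRing.Theory Num.Theory.
Local Open Scope ring_scope.

(** Write eta for the quadratic character of F_p, theta = sum_b e(n b^2 / p),
so that theta^2 = eta(-1) p, and S(chi) = sum_a chi(a) eta(a^2 - 1).  Expanding
the square and substituting a -> a b gives
  |G(n, chi; p)|^2 = theta S(chi) + p (1 + chi(-1)) - (p - 1) [chi trivial].
Cubing and summing over chi, orthogonality turns the power sums of S into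
  sum S = 0,  sum S^2 = (p - 1)(p - 3) eta(-1),  sum S^3 = (p - 1) eta(-1) T,
where T is the sum over a, b <> 0 of eta((a^2 - 1)(b^2 - 1)(a^2 b^2 - 1)).

If eta(-1) = -1 then (a, b) -> (1/a, 1/b) shows T = 0 and the moment is exact.

If eta(-1) = 1 one needs T = O(p).  Replacing the squares a^2, b^2 by u, v with
weights (1 + eta(u))(1 + eta(v)), every term except the one with weight
eta(u v) reduces to character sums of quadratic polynomials.  In that last one
the substitutions v = b/(1 - u), u = (b - 1)/(c - 1) produce
  D = sum_{b, c} eta(b c (b^2 - c)(c - 1)).
With the Jacobsthal sums K(c) = sum_b eta(b (b^2 - c)), the homogeneity
K(c d^2) = eta(d) K(c) yields (p - 1) D = sum_c eta(c) K(c)^2, and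
sum_c K(c)^2 = 2 p (p - 1) elementarily, whence |D| <= 2 p. *)

(** * The quadratic character and the triple sum *)

Lemma finField_prim_root (F : finFieldType) :
  exists g : F, (#|F|.-1).-primitive_root g.
Proof.
have q1 := finNzRing_gt1 F.
have /hasP[g _ gP] : has (#|F|.-1).-primitive_root (enum (predC1 (0 : F))).
  apply: has_prim_root; first by rewrite -subn1 subn_gt0.
  - apply/allP => x; rewrite mem_enum !inE => x0.
    by rewrite unity_rootE; apply/eqP/(mulfI x0); rewrite -exprS (ltn_predK q1) expf_card mulr1.
  - exact: enum_uniq.
  - by rewrite -cardE cardC1.
by exists g.
Qed.

Lemma finField_prim_rootP (F : finFieldType) (g x : F) :
  (#|F|.-1).-primitive_root g -> x != 0 -> exists k, x = g ^+ k.
Proof.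
move=> gP x0; have q1 := finNzRing_gt1 F.
have [|k ->] := prim_rootP gP (x := x); last by exists k.
by apply: (mulfI x0); rewrite -exprS (ltn_predK q1) expf_card mulr1.
Qed.

Section QuadraticCharacter.
Variable F : finFieldType.
Implicit Types a b c d u v x y : F.
Local Notation q := (#|F|%:Z).

(** Integer values allow bounds by absolute value; they are cast into the complex field only for the
    moment. *)
Definition quad (x : F) : int :=
  if x == 0 then 0 else if [exists y, x == y ^+ 2] then 1 else -1.

Lemma quad0 : quad 0 = 0. Proof. by rewrite /quad eqxx. Qed.

Lemma quad_sqr x : x != 0 -> quad (x ^+ 2) = 1.
Proof.
move=> x0; rewrite /quad expf_eq0 (negbTE x0) /=.
by case: existsP => // -[]; exists x.
Qed.

Lemma quad1 : quad 1 = 1.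
Proof. by rewrite -(expr1n F 2) quad_sqr ?oner_eq0. Qed.

(** The real case is that of two nonsquares: both are odd powers of a generator, so their product is
    an even power. *)
Lemma quadM x y : quad (x * y) = quad x * quad y.
Proof.
rewrite /quad mulf_eq0; case: eqVneq => [|x0] /=; first by rewrite mul0r.
case: eqVneq => [|y0] /=; first by rewrite mulr0.
have [g gP] := finField_prim_root F.
have oddlog (z : F) : z != 0 -> ~ (exists w, z == w ^+ 2) -> exists k, z = g ^+ k.*2.+1.
  move=> /(finField_prim_rootP gP)[k ->] nsq; exists k./2; congr (_ ^+ _).
  have [ok|ek] := boolP (odd k); first by lia.
  by case: nsq; exists (g ^+ k./2); apply/eqP; rewrite -exprM; congr (_ ^+ _); lia.
case: (existsP (P := fun s => x == s ^+ 2)) => [[s /eqP sP]|nx];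
  case: (existsP (P := fun s => y == s ^+ 2)) => [[t /eqP tP]|ny];
  case: existsP => //.
- by case; exists (s * t); rewrite exprMn sP tP.
- case=> r /eqP rP; case: ny; exists (r / s); apply/eqP.
  have s0 : s != 0 by apply: contraNneq x0; rewrite sP => ->; rewrite expr0n.
  by rewrite expr_div_n -rP -sP mulrC mulKf.
- case=> r /eqP rP; case: nx; exists (r / t); apply/eqP.
  by rewrite expr_div_n -rP -tP mulfK.
- have [i xi] := oddlog _ x0 nx; have [j yj] := oddlog _ y0 ny.
  case; exists (g ^+ (i + j).+1).
  by apply/eqP; rewrite xi yj -exprM -exprD; congr (_ ^+ _); lia.
Qed.

Lemma quadM_sqr x y : x != 0 -> quad (x ^+ 2 * y) = quad y.
Proof. by move=> x0; rewrite quadM quad_sqr // mul1r. Qed.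

Lemma quad_neq0 x : quad x * quad x = (x != 0)%:R.
Proof.
have [->|x0] := eqVneq x 0; first by rewrite quad0.
by rewrite -quadM -expr2 quad_sqr.
Qed.

Lemma quad_norm x : `|quad x| <= 1.
Proof. by rewrite /quad; case: ifP => // _; case: ifP. Qed.

Hypothesis char2 : (2 : F) != 0.

Lemma neq_opp y : y != 0 -> (y == - y) = false.
Proof.
move=> y0; apply/negbTE; rewrite -subr_eq0 opprK -mulr2n -mulr_natl.
by rewrite mulf_neq0.
Qed.

Lemma sum_sqr_fiber (V : zmodType) (h : F -> V) y : y != 0 ->
  \sum_(x | x ^+ 2 == y ^+ 2) h x = h y + h (- y).
Proof.
move=> y0; rewrite (bigD1 y) ?eqxx //=; congr (_ + _).
rewrite (bigD1 (- y)) /=; last by rewrite sqrrN eqxx eq_sym neq_opp.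
rewrite big1 ?addr0 // => x /andP[/andP[]].
by rewrite eqf_sqr => /orP[] /eqP-> /[!eqxx].
Qed.

Lemma card_sqrt u : (#|[pred x | x ^+ 2 == u]|%:Z) = 1 + quad u.
Proof.
have -> : (#|[pred x | x ^+ 2 == u]|%:Z) = \sum_(x | x ^+ 2 == u) 1.
  by rewrite sumr_const natz.
rewrite /quad; case: eqVneq => [->|u0].
  rewrite (bigD1 0) ?expr0n //= big1 ?addr0 // => x.
  by rewrite expf_eq0 /= => /andP[->].
case: existsP => [[y /eqP uy]|nsq]; last first.
  by rewrite big1 // => x /eqP xu; case: nsq; exists x; rewrite xu.
by rewrite uy (sum_sqr_fiber (fun=> 1)) //; move: u0; rewrite uy expf_eq0.
Qed.

(** Every [u] has [1 + quad u] square roots; this trades squared variables for weights. *)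
Lemma sum_sqr (A : pzRingType) (f : F -> A) :
  \sum_(a : F) f (a ^+ 2) = \sum_(u : F) (1 + quad u)%:~R * f u.
Proof.
rewrite (partition_big (fun a => a ^+ 2) xpredT) //=; apply: eq_bigr => u _.
under eq_bigr => a /eqP -> do [].
by rewrite sumr_const -card_sqrt -pmulrn mulr_natl.
Qed.

Lemma sum_quad : \sum_x quad x = 0.
Proof.
have := sum_sqr (fun=> 1 : int); rewrite sumr_const.
under [in RHS]eq_bigr => u _ do rewrite intz mulr1.
by rewrite big_split /= sumr_const -[X in X = _]addr0 => /addrI.
Qed.

(** If -1 is [g ^+ k], the order of [g], a multiple of 4, divides [k * 2]; hence [k] is even. *)
Lemma quadN1_mod4_1 : (#|F| %% 4 = 1)%N -> quad (-1) = 1.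
Proof.
move=> q4; have [g gP] := finField_prim_root F.
have N1 : (-1 : F) != 0 by rewrite oppr_eq0 oner_eq0.
have [k kP] := finField_prim_rootP gP N1.
have : g ^+ (k * 2) == 1 by rewrite exprM -kP sqrrN expr1n.
rewrite -(prim_order_dvd gP) => /dvdnP[m km].
have ke : k = (k./2 * 2)%N by lia.
by move: N1; rewrite kP ke exprM expf_eq0 => g0; rewrite quad_sqr.
Qed.

(** A square root of -1 raised to the power q - 1 would be an odd power of -1, against Fermat. *)
Lemma quadN1_mod4_3 : (#|F| %% 4 = 3)%N -> quad (-1) = -1.
Proof.
move=> q4; rewrite /quad oppr_eq0 oner_eq0; case: existsP => // -[y /eqP yP].
have y0 : y != 0.
  by apply/eqP => y0; move/eqP: yP; rewrite y0 expr0n oppr_eq0 oner_eq0.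
have : y ^+ #|F|.-1 = 1.
  apply: (mulfI y0).
  by rewrite -exprS (ltn_predK (finNzRing_gt1 F)) expf_card mulr1.
have -> : #|F|.-1 = (2 * (#|F|.-1./2))%N by move: q4; set n := #|F|; lia.
rewrite exprM -yP -signr_odd; have -> : odd (#|F|.-1./2) by move: q4; set n := #|F|; lia.
by rewrite expr1 => /eqP; rewrite eq_sym neq_opp ?oner_eq0.
Qed.

(** Inversion permutes the whole field because the inverse of 0 is 0 by convention. *)
Lemma reindexV (A : nmodType) (f : F -> A) : \sum_x f x = \sum_x f x^-1.
Proof. by rewrite (reindex_inj invr_inj). Qed.

Lemma reindexM (A : nmodType) (f : F -> A) c : c != 0 ->
  \sum_x f x = \sum_x f (c * x).
Proof. by move=> c0; rewrite (reindex_inj (mulfI c0)). Qed.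

Lemma reindexD (A : nmodType) (f : F -> A) c :
  \sum_x f x = \sum_x f (c + x).
Proof. by rewrite (reindex_inj (addrI c)). Qed.

Lemma sum_quad_affine c d : c != 0 -> \sum_x quad (c * x + d) = 0.
Proof.
move=> c0; transitivity (\sum_x quad (d + c * x)).
  by apply: eq_bigr => x _; rewrite addrC.
by rewrite -(reindexM (fun x => quad (d + x)) c0) -(reindexD quad d) sum_quad.
Qed.

Lemma sum_neq0 (h : F -> int) :
  \sum_(x | x != 0) h x = \sum_x h x - h 0.
Proof. by rewrite [in RHS](bigD1 0) //= addrAC subrr add0r. Qed.

(** For distinct roots, a translation and an inversion, followed by multiplication by the square of
    [x], make the argument affine. The affine sum vanishes, and its missing term at 0 leaves -1. *)
Lemma sum_quad_pair u v :
  \sum_x quad ((x - u) * (x - v)) = (if u == v then q else 0) - 1.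
Proof.
rewrite (reindexD _ u) /=.
have E x : (u + x - u) * (u + x - v) = x * (x + (u - v)) by ring.
under eq_bigr => x _ do rewrite E.
rewrite -subr_eq0; case: eqVneq => [->|uv].
  under eq_bigr => x _ do rewrite addr0 quadM quad_neq0.
  rewrite (bigD1 0) //= eqxx add0r.
  under eq_bigr => x -> do [].
  rewrite (sum_neq0 (fun=> 1)) sumr_const natz. by [].
rewrite reindexV (bigD1 0) //= invr0 mul0r quad0 add0r sub0r.
transitivity (\sum_(x | x != 0) quad ((u - v) * x + 1)).
  apply: eq_bigr => x x0; rewrite -(quadM_sqr _ x0); congr quad; field. exact: x0.
by rewrite sum_neq0 sum_quad_affine // !(mulr0, add0r) quad1.
Qed.

End QuadraticCharacter.

(** * Bounding the triple sum when -1 is a square *)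

Section CliqueSum.
Variable F : finFieldType.
Hypothesis char2 : (2 : F) != 0.
Hypothesis quadN1 : @quad F (-1) = 1.
Implicit Types a b c d u v x y : F.
Local Notation q := (#|F|%:Z).

Lemma quadN x : quad (- x) = quad x.
Proof. by rewrite -mulN1r quadM quadN1 mul1r. Qed.

Definition jacobsthal c := \sum_(b : F) quad (b * (b ^+ 2 - c)).

(** Replacing [b] by [d * b] pulls out the cube of [d], which has the same character as [d]. *)
Lemma jacobsthalM_sqr c d : d != 0 ->
  jacobsthal (c * d ^+ 2) = quad d * jacobsthal c.
Proof.
move=> d0; rewrite /jacobsthal (reindexM _ d0) mulr_sumr; apply: eq_bigr => b _.
rewrite -quadM -(quadM_sqr (d * _) d0); congr quad; ring.
Qed.

(** Expanding the square and summing over [c] first leaves the diagonal [b = a] or [b = - a], where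
    [quad (a * b)] is 1 in both cases because -1 is a square. *)
Lemma sum_jacobsthal_sqr : \sum_(c : F) jacobsthal c ^+ 2 = 2 * q * (q - 1).
Proof.
under eq_bigr => c _ do rewrite expr2 mulr_suml.
under eq_bigr => c _ do under eq_bigr => a _ do rewrite mulr_sumr.
rewrite exchange_big /=; under eq_bigr => a _ do rewrite exchange_big /=.
transitivity (\sum_(a : F) \sum_(b : F) quad (a * b) * ((if b ^+ 2 == a ^+ 2 then q else 0) - 1)).
  apply: eq_bigr => a _; apply: eq_bigr => b _.
  rewrite eq_sym -sum_quad_pair // mulr_sumr; apply: eq_bigr => c _.
  by rewrite -!quadM; congr quad; ring.
transitivity (\sum_(a : F) (if a == 0 then 0 else 2 * q)).
  apply: eq_bigr => a _; case: eqVneq => [->|a0].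
    by apply: big1 => b _; rewrite mul0r quad0 mul0r.
  under eq_bigr => b _ do rewrite mulrBr mulr1 quadM.
  rewrite sumrB -mulr_sumr sum_quad // mulr0 subr0.
  under eq_bigr => b _ do rewrite -quadM (fun_if ( *%R _)) mulr0.
  rewrite -big_mkcond sum_sqr_fiber // mulrN quadN -expr2 quad_sqr //; ring.
rewrite (bigD1 0) //= eqxx add0r.
under eq_bigr => a /negbTE -> do [].
rewrite (sum_neq0 (fun=> 2 * q)) sumr_const -mulr_natl natz; ring.
Qed.

(** Average over [d != 0] after scaling [c] by the square of [d]: homogeneity extracts
    [jacobsthal c], and the remaining sum over [d] is a second copy of it after inverting [d]. *)
Lemma quad_clique_sum :
  (q - 1) * (\sum_(c : F) \sum_(b : F) quad (b * c * (b ^+ 2 - c) * (c - 1)))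
  = \sum_(c : F) quad c * jacobsthal c ^+ 2.
Proof.
pose D := \sum_(c : F) quad (c * (c - 1)) * jacobsthal c.
have DE : \sum_(c : F) \sum_(b : F) quad (b * c * (b ^+ 2 - c) * (c - 1)) = D.
  apply: eq_bigr => c _; rewrite mulr_sumr; apply: eq_bigr => b _.
  by rewrite -quadM; congr quad; ring.
transitivity (\sum_(d : F | d != 0) D).
  by rewrite (sum_neq0 (fun=> D)) sumr_const DE -mulr_natl natz; ring.
transitivity (\sum_(d : F) \sum_(c : F) quad c * jacobsthal c * quad (d * (c * d ^+ 2 - 1))).
  rewrite [RHS](bigD1 0) //= [X in X + _]big1 ?add0r; last first.
    by move=> c _; rewrite mul0r quad0 mulr0.
  apply: eq_bigr => d d0.
  rewrite /D (reindexM _ (expf_neq0 2 d0)); apply: eq_bigr => c _.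
  rewrite [d ^+ 2 * c]mulrC jacobsthalM_sqr // [c * d ^+ 2 * _]mulrC.
  by rewrite !quadM quad_neq0 d0 mulr1; ring.
rewrite exchange_big; apply: eq_bigr => c _; rewrite -mulr_sumr /= expr2 mulrA.
congr (_ * _); rewrite reindexV /jacobsthal; apply: eq_bigr => d _.
have [->|d0] := eqVneq d 0; first by rewrite invr0 !mul0r.
rewrite -quadN -(quadM_sqr (- _) (expf_neq0 2 d0)); congr quad; field. exact: d0.
Qed.

Lemma quad_clique_sum_bound :
  `|\sum_(c : F) \sum_(b : F) quad (b * c * (b ^+ 2 - c) * (c - 1))| <= 2 * q.
Proof.
have q1 : 0 < q - 1 by rewrite subr_gt0 ltz_nat; apply: finNzRing_gt1.
rewrite -(ler_pM2l q1) -{1}(gtr0_norm q1) -normrM quad_clique_sum.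
rewrite [leRHS]mulrC -sum_jacobsthal_sqr; apply: le_trans (ler_norm_sum _ _ _) _.
apply: ler_sum => c _; rewrite normrM normrX real_normK ?num_real //.
by rewrite ler_piMl ?sqr_ge0 ?quad_norm.
Qed.

Lemma quad_clique_sum_sym :
  \sum_(u : F) \sum_(v : F) quad (u * v * (u - 1) * (v - 1) * (u * v - 1))
  = \sum_(c : F) \sum_(b : F) quad (b * c * (b ^+ 2 - c) * (c - 1)).
Proof.
transitivity (\sum_(u : F) \sum_(b : F) quad (u * b * (b - 1 + u) * (u * (b + 1) - 1))).
  apply: eq_bigr => u _; have [->|u1] := eqVneq u 1.
    rewrite big1 => [|v _]; last by rewrite subrr mulr0 !mul0r quad0.
    symmetry; transitivity (\sum_(b : F) quad b); last exact: sum_quad.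
    apply: eq_bigr => b _.
    have [->|b0] := eqVneq b 0; first by rewrite mulr0 !mul0r.
    by rewrite -(quadM_sqr b b0); congr quad; ring.
  have u1' : 1 - u != 0 by rewrite subr_eq0 eq_sym.
  have u1'' : u - 1 != 0 by rewrite subr_eq0.
  rewrite (reindexM _ (invr_neq0 u1')); apply: eq_bigr => b _.
  rewrite -quadN -(quadM_sqr (- _) u1'); congr quad; field. by [].
rewrite exchange_big [RHS]exchange_big; apply: eq_bigr => b _ /=.
(* At [b = 1] the next substitution degenerates; both sides are then -1. *)
have [->|b1] := eqVneq b 1.
  transitivity (\sum_(u : F | u != 0) quad (2 * u + -1)).
    rewrite (bigD1 0) //= !mul0r quad0 add0r; apply: eq_bigr => u u0.
    by rewrite -(quadM_sqr (_ + _) u0); congr quad; ring.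
  rewrite sum_neq0 sum_quad_affine // !(mulr0, add0r) quadN1.
  transitivity (\sum_(c : F | c != 1) quad c).
    by have /eqP := sum_quad char2; rewrite (bigD1 1) //= quad1 addrC addr_eq0 => /eqP.
  rewrite [RHS](bigD1 1) //= subrr mulr0 quad0 add0r; apply: eq_bigr => c c1.
  have c1' : 1 - c != 0 by rewrite subr_eq0 eq_sym.
  by rewrite -quadN -[LHS](quadM_sqr _ c1'); congr quad; ring.
have b1' : b - 1 != 0 by rewrite subr_eq0.
(* Substitution [c = 1 + (b - 1) / u]; the value [u = 0] is matched with [c = 1], where both terms
   vanish. *)
rewrite [RHS](reindexD _ 1) [RHS](reindexM _ b1') [RHS]reindexV.
apply: eq_bigr => u _; have [->|u0] := eqVneq u 0.
  by rewrite invr0 !(mul0r, mulr0, addr0) subrr mulr0.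
rewrite -[RHS](quadM_sqr _ (expf_neq0 2 u0)) -[LHS](quadM_sqr _ b1').
congr quad; field. exact: u0.
Qed.

Lemma sum_quad_1_1 (u : F) : u != 0 -> u != 1 ->
  \sum_(v : F | v != 0) quad ((v - 1) * (u * v - 1)) = - quad u - 1.
Proof.
move=> u0 u1; rewrite sum_neq0 mulr0 !sub0r mulrNN mulr1 quad1; congr (_ - _).
transitivity (\sum_(v : F) quad u * quad ((v - 1) * (v - u^-1))).
  by apply: eq_bigr => v _; rewrite -quadM; congr quad; field.
rewrite -mulr_sumr sum_quad_pair // -[1 in X in if X then _ else _]invr1.
by rewrite (inj_eq invr_inj) eq_sym (negbTE u1) sub0r mulrN1.
Qed.

Definition triple_sum := \sum_(a : F | a != 0) \sum_(b : F | b != 0)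
  quad ((a ^+ 2 - 1) * (b ^+ 2 - 1) * (a ^+ 2 * b ^+ 2 - 1)).

(** For each [u] the inner sum is at most 2 in absolute value by [sum_quad_1_1], so a weight
    depending on [u] alone costs only O(q). *)
Lemma sum_quad_weight_bound (h : F -> int) : (forall u, `|h u| <= 1) ->
  `|\sum_(u : F | u != 0) h u * \sum_(v : F | v != 0) quad ((u - 1) * (v - 1) * (u * v - 1))|
  <= 2 * q.
Proof.
move=> h1; apply: le_trans (ler_norm_sum _ _ _) _.
apply: (@le_trans _ _ (\sum_(u : F | u != 0) 2)); last first.
  rewrite (sum_neq0 (fun=> 2)) sumr_const -[X in X - _]mulr_natl natz.
  by rewrite mulrC gerBl.
apply: ler_sum => u u0; rewrite normrM -[leRHS]mul1r ler_pM ?h1 //.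
have [->|u1] := eqVneq u 1.
  by rewrite big1 ?normr0 // => v _; rewrite subrr !mul0r quad0.
under eq_bigr => v _ do rewrite -mulrA quadM.
rewrite -mulr_sumr sum_quad_1_1 // normrM -[leRHS]mul1r ler_pM ?quad_norm //.
by rewrite (le_trans (ler_normB _ _)) // normrN normr1 -[leRHS]/(1 + 1) lerD2r quad_norm.
Qed.

Lemma triple_sumE : triple_sum =
  \sum_(u : F | u != 0) \sum_(v : F | v != 0)
    (1 + quad u) * (1 + quad v) * quad ((u - 1) * (v - 1) * (u * v - 1)).
Proof.
pose t u v := quad ((u - 1) * (v - 1) * (u * v - 1)).
have sum_sqr0 (f : F -> int) :
    \sum_(a : F | a != 0) f (a ^+ 2) = \sum_(u : F | u != 0) (1 + quad u) * f u.
  (* The weight at [u = 0] is 1, so the same term [f 0] is removed on both sides. *)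
  rewrite (sum_neq0 (fun a => f (a ^+ 2))) sum_sqr // sum_neq0 expr0n quad0 addr0 mul1r.
  by congr (_ - _); apply: eq_bigr => u _; rewrite intz.
rewrite /triple_sum (sum_sqr0 (fun u => \sum_(b : F | b != 0) t u (b ^+ 2))).
apply: eq_bigr => u u0; rewrite sum_sqr0 mulr_sumr.
by apply: eq_bigr => v _; rewrite mulrA.
Qed.

(** The product of weights splits into four sums, each at most [2 * q]; the two mixed ones agree by
    symmetry in [u] and [v]. *)
Lemma triple_sum_bound : `|triple_sum| <= 8 * q.
Proof.
pose t u v := quad ((u - 1) * (v - 1) * (u * v - 1)).
pose W (h : F -> int) := \sum_(u : F | u != 0) h u * \sum_(v : F | v != 0) t u v.
pose A := \sum_(u : F) \sum_(v : F) quad (u * v * (u - 1) * (v - 1) * (u * v - 1)).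
have -> : triple_sum = W (fun=> 1) + W (@quad F) + W (@quad F) + A.
  have WC : W (@quad F) = \sum_(u : F | u != 0) \sum_(v : F | v != 0) quad v * t u v.
    rewrite exchange_big; apply: eq_bigr => u _; rewrite mulr_sumr.
    by apply: eq_bigr => v _; rewrite /t; congr (_ * quad _); ring.
  rewrite {2}WC triple_sumE.
  have -> : A = \sum_(u : F | u != 0) \sum_(v : F | v != 0) quad u * quad v * t u v.
    rewrite /A (bigD1 0) //= [X in X + _]big1 ?add0r; last first.
      by move=> v _; rewrite !mul0r quad0.
    apply: eq_bigr => u _; rewrite (bigD1 0) //= mulr0 !mul0r quad0 add0r.
    by apply: eq_bigr => v _; rewrite -!quadM; congr quad; ring.
  rewrite -!big_split /=; apply: eq_bigr => u _.
  rewrite !mulr_sumr -!big_split /=; apply: eq_bigr => v _; rewrite /t; ring.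
have B1 : `|W (fun=> 1)| <= 2 * q by apply: sum_quad_weight_bound.
have B2 : `|W (@quad F)| <= 2 * q by apply: sum_quad_weight_bound; apply: quad_norm.
have B3 : `|A| <= 2 * q by rewrite /A quad_clique_sum_sym quad_clique_sum_bound.
have -> : 8 * q = 2 * q + 2 * q + 2 * q + 2 * q by ring.
do 3!rewrite (le_trans (ler_normD _ _)) // lerD //.
Qed.

End CliqueSum.

Lemma triple_sum_eq0 (F : finFieldType) : @quad F (-1) = -1 -> triple_sum F = 0.
Proof.
move=> quadN1; have qN (x : F) : quad (- x) = - quad x.
  by rewrite -mulN1r quadM quadN1 mulN1r.
suff : triple_sum F = - triple_sum F by lia.
have invN0 (h : F -> int) : \sum_(a : F | a != 0) h a = \sum_(a : F | a != 0) h a^-1.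
  by rewrite (reindex_inj invr_inj); apply: eq_bigl => a; rewrite invr_eq0.
rewrite {1}/triple_sum invN0 -sumrN; apply: eq_bigr => a a0.
rewrite invN0 -sumrN; apply: eq_bigr => b b0.
rewrite -qN -[LHS](quadM_sqr _ (expf_neq0 2 (mulf_neq0 a0 b0))).
by congr quad; field; rewrite a0 b0.
Qed.

(** * The sixth moment in terms of quadratic character sums *)

Section SixthMoment.
Variables (F : finFieldType) (C : numClosedFieldType) (I : finType).
Variables (chi : I -> F -> C) (i0 : I) (psi : F -> C).
Hypothesis char2 : (2 : F) != 0.
Local Notation q := (#|F|%:R : C).
Local Notation eta x := ((@quad F x)%:~R : C).

Hypothesis chiM : forall i x y, chi i (x * y) = chi i x * chi i y.
Hypothesis chi1 : forall i, chi i 1 = 1.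
Hypothesis chi_conj : forall i x, (chi i x)^* = chi i x^-1.
Hypothesis chi_trivial : forall x, chi i0 x = (x != 0)%:R.
Hypothesis sum_chi_index : forall x, \sum_i chi i x = if x == 1 then q - 1 else 0.
Hypothesis sum_chi : forall i, \sum_x chi i x = if i == i0 then q - 1 else 0.
Hypothesis chi0 : forall i, chi i 0 = 0.
Hypothesis psiD : forall x y, psi (x + y) = psi x * psi y.
Hypothesis psi0 : psi 0 = 1.
Hypothesis psi_conj : forall x, (psi x)^* = psi (- x).
Hypothesis sum_psi : \sum_x psi x = 0.

Definition gauss_quad := \sum_b psi (b ^+ 2).

Lemma sum_psi_mul c : \sum_x psi (c * x) = if c == 0 then q else 0.
Proof.
case: eqVneq => [->|c0]; last by rewrite -(reindexM psi c0).
by under eq_bigr => x _ do rewrite mul0r psi0; rewrite sumr_const.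
Qed.

Lemma gauss_quad_eta : gauss_quad = \sum_u eta u * psi u.
Proof.
rewrite /gauss_quad sum_sqr // -[RHS]add0r -[X in X + _]sum_psi -big_split /=.
by apply: eq_bigr => u _; rewrite intrD mulrDl mul1r.
Qed.

(** The last term is needed at [c = 0], where the character vanishes but the sum is q. *)
Lemma sum_psi_sqr c :
  \sum_b psi (c * b ^+ 2) = eta c * gauss_quad + (if c == 0 then q else 0).
Proof.
rewrite (sum_sqr char2 (fun u => psi (c * u))) -sum_psi_mul gauss_quad_eta.
under eq_bigr => u _ do rewrite intrD mulrDl mul1r.
rewrite big_split /= addrC; congr (_ + _).
have [->|c0] := eqVneq c 0.
  rewrite quad0 mul0r; under eq_bigr => u _ do rewrite mul0r psi0 mulr1.
  by rewrite -(rmorph_sum (intmul 1)) sum_quad.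
rewrite (reindexM (fun u => eta u * psi u) c0) mulr_sumr; apply: eq_bigr => u _.
by rewrite quadM intrM !mulrA -intrM quad_neq0 c0 mul1r.
Qed.

(** Writing the second variable as [u * w], the sum of [psi ((1 + w) * u)] over [u != 0] is q - 1 at
    [w = -1] and -1 elsewhere; the constant -1 dies against the sum of [eta w]. *)
Lemma gauss_quad_sqr : gauss_quad ^+ 2 = eta (-1) * q.
Proof.
rewrite expr2 {1 2}gauss_quad_eta mulr_suml.
transitivity (\sum_(u : F) \sum_(w : F) (u != 0)%:R * eta w * psi ((1 + w) * u)).
  apply: eq_bigr => u _; rewrite mulr_sumr; have [->|u0] := eqVneq u 0.
    by rewrite !big1 // => w _; rewrite ?quad0 !mul0r.
  rewrite (reindexM _ u0); apply: eq_bigr => w _.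
  rewrite mulrDl mul1r (mulrC w u) psiD quadM intrM.
  have -> : (true%:R : C) = eta u * eta u by rewrite -intrM quad_neq0 u0.
  by ring.
rewrite exchange_big /=.
transitivity (\sum_(w : F) (eta w * (if w == -1 then q else 0) - eta w)).
  apply: eq_bigr => w _; rewrite -addr_eq0 (addrC w) -sum_psi_mul mulr_sumr.
  rewrite (bigD1 0) //= eqxx !mul0r add0r [in RHS](bigD1 0) //= mulr0 psi0.
  rewrite mulr1 addrAC subrr add0r; apply: eq_bigr => u ->.
  by rewrite mul1r.
rewrite sumrB -(rmorph_sum (intmul 1)) sum_quad // subr0 (bigD1 (-1)) //= eqxx.
by rewrite big1 ?addr0 // => w /negbTE ->; rewrite mulr0.
Qed.

Definition gauss i := \sum_a chi i a * psi (a ^+ 2).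
Definition shift_sum i := \sum_a chi i a * eta (a ^+ 2 - 1).
Local Notation G := gauss.
Local Notation S := shift_sum.
Local Notation theta := gauss_quad.

Lemma gauss_norm2 i : `|G i| ^+ 2 =
  theta * S i - (if i == i0 then q - 1 else 0) + q * (1 + chi i (-1)).
Proof.
rewrite normCK rmorph_sum /= mulr_sumr.
transitivity (\sum_(b : F | b != 0) \sum_(a : F) chi i a * psi ((a ^+ 2 - 1) * b ^+ 2)).
  rewrite (bigD1 0) //= chi0 mul0r rmorph0 mulr0 add0r; apply: eq_bigr => b b0.
  rewrite mulr_suml (reindexM _ b0); apply: eq_bigr => a _.
  rewrite rmorphM /= chi_conj psi_conj chiM exprMn mulrBl mul1r psiD (mulrC (a ^+ 2)).
  have chiE : chi i a = chi i b * chi i a * chi i b^-1.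
    by rewrite mulrC mulrA -chiM mulVf // chi1 mul1r.
  by rewrite [in RHS]chiE; ring.
rewrite exchange_big /=.
transitivity (\sum_(a : F) (theta * (chi i a * eta (a ^+ 2 - 1)) - chi i a
   + chi i a * (if a ^+ 2 == 1 then q else 0))).
  (* The sum over nonzero [b] is the full sum less its term 1 at [b = 0]; this produces the
     [- chi i a]. *)
  apply: eq_bigr => a _; rewrite -mulr_sumr.
  have := sum_psi_sqr (a ^+ 2 - 1); rewrite (bigD1 0) //= expr0n mulr0 psi0 subr_eq0.
  by move/(canRL (addKr _)) ->; move: (if _ then _ else _) => t; ring.
rewrite big_split sumrB -mulr_sumr sum_chi /=; congr (_ + _).
under eq_bigr => a _ do rewrite (fun_if ( *%R _)) mulr0.
rewrite -big_mkcond -{1}(expr1n F 2) sum_sqr_fiber ?oner_eq0 // chi1; ring.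
Qed.

Lemma shift_sum_even i : chi i (-1) * S i = S i.
Proof.
have N1 : (-1 : F) != 0 by rewrite oppr_eq0 oner_eq0.
rewrite {2}/shift_sum (reindexM _ N1) mulr_sumr; apply: eq_bigr => a _.
by rewrite chiM mulN1r sqrrN mulrA.
Qed.

Lemma chiN1_sqr i : chi i (-1) ^+ 2 = 1.
Proof. by rewrite expr2 -chiM mulrNN mulr1 chi1. Qed.

Lemma shift_sum_trivial : S i0 = - 1 - eta (-1).
Proof.
rewrite /shift_sum (bigD1 0) //= chi0 mul0r add0r.
transitivity (\sum_(a : F | a != 0) eta (a ^+ 2 - 1)).
  by apply: eq_bigr => a a0; rewrite chi_trivial a0 mul1r.
rewrite -(rmorph_sum (intmul 1)) sum_neq0 expr0n sub0r.
under eq_bigr => a _ do rewrite -{1}(expr1n F 2) subr_sqr -{1}[1]opprK.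
rewrite (eq_bigr (fun x => quad ((x - 1) * (x - -1)))) => [|x _]; last by rewrite opprK.
by rewrite sum_quad_pair // neq_opp ?oner_eq0 // sub0r (rmorphB (intmul 1)) rmorphN1.
Qed.

Lemma sum_shift_sum : \sum_i S i = 0.
Proof.
rewrite exchange_big big1 // => a _; rewrite -mulr_suml sum_chi_index.
by case: eqP => [->|_]; rewrite ?mul0r // expr1n subrr quad0 mulr0.
Qed.

(** The indicator is what summing characters over the index yields. In the third moment [a] will be
    a product of two variables. *)
Lemma sum_inv (h : F -> F -> C) (a : F) : a != 0 ->
  \sum_b h a b * (if a * b == 1 then q - 1 else 0) = h a a^-1 * (q - 1).
Proof.
move=> a0; rewrite (bigD1 a^-1) //= divff // eqxx big1 ?addr0 // => b ba.
case: eqP => [ab|]; rewrite ?mulr0 //; case/eqP: ba.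
by rewrite -[b](mulKf a0) ab mulr1.
Qed.

(** Orthogonality pairs [a] with its inverse, whose factor is [eta (-1)] times that of [a]. What
    remains counts the q - 3 elements other than 0, 1 and -1. *)
Lemma sum_shift_sum2 : \sum_i S i ^+ 2 = (q - 1) * (q - 3) * eta (-1).
Proof.
transitivity (\sum_(a : F | a != 0) eta (a ^+ 2 - 1) * eta (a^-1 ^+ 2 - 1) * (q - 1)).
  under eq_bigr => i _ do rewrite expr2 mulr_suml.
  rewrite exchange_big (bigD1 0) //= big1 ?add0r => [|i _]; last by rewrite chi0 !mul0r.
  apply: eq_bigr => a a0.
  rewrite -(sum_inv (fun a b => eta (a ^+ 2 - 1) * eta (b ^+ 2 - 1))) //.
  under eq_bigr => i _ do rewrite mulr_sumr.
  rewrite exchange_big; apply: eq_bigr => b _.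
  rewrite -sum_chi_index mulr_sumr; apply: eq_bigr => i _ /=.
  by rewrite chiM; ring.
transitivity ((q - 1) * eta (-1) * \sum_(a : F | a != 0) (1 - (if a ^+ 2 == 1 then 1 else 0))).
  rewrite mulr_sumr; apply: eq_bigr => a a0.
  have -> : 1 - (if a ^+ 2 == 1 then 1 else 0) = eta (a ^+ 2 - 1) * eta (a ^+ 2 - 1).
    by rewrite -intrM quad_neq0 subr_eq0; case: eqP; rewrite ?subrr ?subr0.
  rewrite -(quadM_sqr (a^-1 ^+ 2 - 1) a0).
  have -> : a ^+ 2 * (a^-1 ^+ 2 - 1) = -1 * (a ^+ 2 - 1) by field.
  by rewrite quadM intrM; ring.
rewrite -mulrA [eta (-1) * _]mulrC mulrA; congr (_ * _ * _).
have : \sum_(a : F) (1 - (if a ^+ 2 == 1 then 1 else 0 : C)) = q - 2.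
  rewrite sumrB sumr_const -big_mkcond -{1}(expr1n F 2) sum_sqr_fiber ?oner_eq0 //.
rewrite (bigD1 0) //= expr0n eq_sym oner_eq0 subr0 => /(canRL (addKr _)) ->.
by ring.
Qed.

Lemma sum_shift_sum3 : \sum_i S i ^+ 3 = (q - 1) * eta (-1) * (triple_sum F)%:~R.
Proof.
pose H (a : F) := eta (a ^+ 2 - 1).
transitivity (\sum_(a : F | a != 0) \sum_(b : F | b != 0) H a * H b * H (a * b)^-1 * (q - 1)).
  under eq_bigr => i _ do rewrite exprS expr2 mulr_suml.
  rewrite exchange_big (bigD1 0) //= big1 ?add0r => [|i _]; last by rewrite chi0 !mul0r.
  apply: eq_bigr => a a0.
  under eq_bigr => i _ do rewrite mulr_suml mulr_sumr.
  rewrite exchange_big (bigD1 0) //= big1 ?add0r => [|i _]; last by rewrite chi0 !(mul0r, mulr0).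
  apply: eq_bigr => b b0.
  rewrite -(sum_inv (fun ab c => H a * H b * H c)) ?mulf_neq0 //.
  under eq_bigr => i _ do rewrite !mulr_sumr.
  rewrite exchange_big; apply: eq_bigr => c _.
  rewrite -sum_chi_index mulr_sumr; apply: eq_bigr => i _ /=.
  by rewrite !chiM /H; ring.
rewrite /triple_sum rmorph_sum /= mulr_sumr; apply: eq_bigr => a a0.
rewrite rmorph_sum /= mulr_sumr; apply: eq_bigr => b b0.
rewrite /H -(quadM_sqr ((a * b)^-1 ^+ 2 - 1) (mulf_neq0 a0 b0)).
have -> : (a * b) ^+ 2 * ((a * b)^-1 ^+ 2 - 1) = -1 * (a ^+ 2 * b ^+ 2 - 1).
  by field; rewrite a0 b0.
by rewrite !quadM !intrM; ring.
Qed.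

(* Odd characters have [S i = 0], so [1 + chi i (-1)] acts on [S i] as [2]. *)
Lemma sum_gauss_norm6 : \sum_i `|G i| ^+ 6 =
  theta ^+ 3 * ((q - 1) * eta (-1) * (triple_sum F)%:~R)
  + 6 * q ^+ 2 * (q - 1) * (q - 3) + 4 * q ^+ 3 * (q - 1)
  + (theta * S i0 + q + 1) ^+ 3 - (theta * S i0 + 2 * q) ^+ 3.
Proof.
(* [Z i] is the squared norm without the correction at the trivial character, which is restored at
   the end. *)
pose Z i := theta * S i + q * (1 + chi i (-1)).
have Z3 i : Z i ^+ 3 = theta ^+ 3 * S i ^+ 3 + 6 * q * theta ^+ 2 * S i ^+ 2
    + 12 * q ^+ 2 * theta * S i + 4 * q ^+ 3 + 4 * q ^+ 3 * chi i (-1).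
  have e2 := chiN1_sqr i; have eS := shift_sum_even i.
  rewrite /Z; move: (chi i (-1)) (S i) e2 eS => e s e2 es.
  have es2 : e * s ^+ 2 = s ^+ 2 by rewrite expr2 mulrA es.
  have -> : (theta * s + q * (1 + e)) ^+ 3 = theta ^+ 3 * s ^+ 3
     + 3 * theta ^+ 2 * q * (s ^+ 2 + e * s ^+ 2)
     + 3 * theta * q ^+ 2 * (s + 2 * (e * s) + e ^+ 2 * s)
     + q ^+ 3 * (1 + 3 * e + 3 * e ^+ 2 + e ^+ 2 * e) by ring.
  by rewrite es2 es e2; ring.
have Z3sum : \sum_i Z i ^+ 3 =
  theta ^+ 3 * ((q - 1) * eta (-1) * (triple_sum F)%:~R)
  + 6 * q ^+ 2 * (q - 1) * (q - 3) + 4 * q ^+ 3 * (q - 1).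
  under eq_bigr => i _ do rewrite Z3.
  rewrite !big_split /= -!mulr_sumr sum_shift_sum sum_shift_sum2 sum_shift_sum3.
  rewrite sum_chi_index (eq_sym (-1)) neq_opp ?oner_eq0 //.
  (* The number of characters is read off from orthogonality at 1. *)
  have -> : \sum_(i : I) q = q * (q - 1).
    have := sum_chi_index 1; rewrite eqxx => <-; rewrite mulr_sumr.
    by apply: eq_bigr => i _; rewrite chi1 mulr1.
  rewrite gauss_quad_sqr.
  have N1 : eta (-1) * eta (-1) = 1 by rewrite -intrM quad_neq0 oppr_eq0 oner_eq0.
  have -> : 6 * q * (eta (-1) * q) * ((q - 1) * (q - 3) * eta (-1))
     = 6 * q ^+ 2 * (q - 1) * (q - 3) * (eta (-1) * eta (-1)) by ring.
  by rewrite N1; ring.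
have GZ i : i != i0 -> `|G i| ^+ 6 = Z i ^+ 3.
  move=> /negbTE ne; rewrite (exprM _ 2 3) gauss_norm2 ne; congr (_ ^+ 3).
  by rewrite /Z subr0.
have Z0 : Z i0 = theta * S i0 + 2 * q.
  by rewrite /Z chi_trivial oppr_eq0 oner_eq0 /= -[true%:R]/(1 : C); ring.
rewrite (bigD1 i0) //= (eq_bigr _ GZ) -Z3sum [in RHS](bigD1 i0) //= Z0.
rewrite (exprM _ 2 3) gauss_norm2 eqxx chi_trivial oppr_eq0 oner_eq0 /= -[true%:R]/(1 : C).
by ring.
Qed.

End SixthMoment.

(** * Multiplicative characters of a finite field *)

(** A permutation of the field multiplies the sum by [c]. This serves multiplicative and additive
    characters alike. *)
Lemma sum_eigen_eq0 (F : finFieldType) (C : fieldType) (h : F -> C) (c : C) (s : F -> F) :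
  injective s -> c != 1 -> (forall x, h (s x) = c * h x) -> \sum_x h x = 0.
Proof.
move=> s_inj c1 hs; apply/eqP; have : (1 - c) * \sum_x h x == 0.
  rewrite mulrBl mul1r subr_eq0 mulr_sumr [eqbLHS](reindex_inj s_inj).
  by rewrite (eq_bigr _ (fun x _ => hs x)).
by rewrite mulf_eq0 subr_eq0 eq_sym (negbTE c1).
Qed.

Section FiniteFieldCharacters.
Variables (F : finFieldType) (C : numClosedFieldType) (g : F) (zeta : C).
Local Notation n := (#|F|.-1).
Hypotheses (gP : n.-primitive_root g) (zetaP : n.-primitive_root zeta).

Lemma finField_prim_root_neq0 : g != 0.
Proof. by rewrite (prim_root_eq0 gP) -lt0n (prim_order_gt0 gP). Qed.

(** The default 0 is reached only at [x = 0], which [ff_char] treats apart. *)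
Definition dlog (x : F) : nat := odflt 0%N (omap val [pick k : 'I_n | x == g ^+ k]).

Lemma dlogK x : x != 0 -> g ^+ dlog x = x.
Proof.
move=> x0; rewrite /dlog; case: pickP => [k /eqP //|no_k].
have [k xk] := finField_prim_rootP gP x0.
have [|i xi] := prim_rootP gP (x := x); last by have := no_k i; rewrite xi eqxx.
by rewrite xk exprAC (prim_expr_order gP) expr1n.
Qed.

Definition ff_char (k : nat) (x : F) : C :=
  if x == 0 then 0 else (zeta ^+ dlog x) ^+ k.

Lemma ff_char0 k : ff_char k 0 = 0.
Proof. by rewrite /ff_char eqxx. Qed.

(** Logarithms matter only modulo the common order of [g] and [zeta]. *)
Lemma ff_char_gX k m : ff_char k (g ^+ m) = zeta ^+ (m * k).
Proof.
have g0 : g ^+ m != 0.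
  by rewrite expf_neq0 // finField_prim_root_neq0.
rewrite /ff_char (negbTE g0) exprM; congr (_ ^+ _); apply/eqP.
by rewrite (eq_prim_root_expr zetaP) -(eq_prim_root_expr gP) dlogK.
Qed.

Lemma ff_charM k x y : ff_char k (x * y) = ff_char k x * ff_char k y.
Proof.
have [->|x0] := eqVneq x 0; first by rewrite !(mul0r, ff_char0).
have [->|y0] := eqVneq y 0; first by rewrite !(mulr0, ff_char0).
rewrite -(dlogK x0) -(dlogK y0) -exprD !ff_char_gX.
by rewrite mulnDl exprD.
Qed.

Lemma ff_char1 k : ff_char k 1 = 1.
Proof. by rewrite -(expr0 g) ff_char_gX mul0n. Qed.

Lemma ff_char_eq0 k x : (ff_char k x == 0) = (x == 0).
Proof.
have [->|x0] := eqVneq x 0; first by rewrite ff_char0 eqxx.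
apply/eqP => c0; have := ff_char1 k; rewrite -(divff x0) ff_charM c0 mul0r.
by move/eqP; rewrite eq_sym oner_eq0.
Qed.

Lemma ff_charX k x m : ff_char k (x ^+ m) = ff_char k x ^+ m.
Proof. by elim: m => [|m IH]; rewrite ?ff_char1 // !exprS ff_charM IH. Qed.

Lemma ff_char_conj k x : (ff_char k x)^* = ff_char k x^-1.
Proof.
have [->|x0] := eqVneq x 0; first by rewrite invr0 ff_char0 rmorph0.
have c0 : ff_char k x != 0 by rewrite ff_char_eq0.
have n1 : `|ff_char k x| = 1.
  apply/eqP; rewrite -(@pexpr_eq1 _ _ n) ?(prim_order_gt0 gP) // -normrX -ff_charX.
  by rewrite -(dlogK x0) exprAC (prim_expr_order gP) expr1n ff_char1 normr1.
by apply: (mulfI c0); rewrite -normCK n1 expr1n -ff_charM divff // ff_char1.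
Qed.

(** For [x] other than 0 and 1 this is a full geometric sum whose ratio is a root of unity different
    from 1. *)
Lemma sum_ff_char_index x :
  \sum_(k < n) ff_char k x = if x == 1 then #|F|%:R - 1 else 0.
Proof.
have [->|x1] := eqVneq x 1.
  under eq_bigr => k _ do rewrite ff_char1.
  rewrite sumr_const card_ord -subn1 natrB //.
  exact: ltnW (finNzRing_gt1 F).
have [->|x0] := eqVneq x 0; first by rewrite big1 // => k _; rewrite ff_char0.
rewrite /ff_char (negbTE x0).
have z1 : zeta ^+ dlog x - 1 != 0.
  by rewrite subr_eq0 -(prim_order_dvd zetaP) (prim_order_dvd gP) dlogK.
by apply: (mulfI z1); rewrite -subrX1 mulr0 exprAC (prim_expr_order zetaP) expr1n subrr.
Qed.

Lemma ff_char_trivial x : ff_char 0 x = (x != 0)%:R.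
Proof. by rewrite /ff_char expr0; case: eqP. Qed.

Lemma sum_ff_char (k : nat) : (k < n)%N ->
  \sum_x ff_char k x = if k == 0%N then #|F|%:R - 1 else 0.
Proof.
move=> kn; case: eqVneq => [->|k0].
  rewrite (bigD1 0) //= ff_char0 add0r.
  under eq_bigr => x x0 do rewrite ff_char_trivial x0.
  rewrite sumr_const (cardC1 (0 : F)) -subn1 natrB //.
  exact: ltnW (finNzRing_gt1 F).
apply: (@sum_eigen_eq0 F C _ (zeta ^+ k) (fun x => g * x)).
- exact: mulfI finField_prim_root_neq0.
- by rewrite -(prim_order_dvd zetaP) gtnNdvd // lt0n.
- by move=> x; rewrite ff_charM -{1}(expr1 g) ff_char_gX mul1n.
Qed.

End FiniteFieldCharacters.

Local Open Scope complex_scope.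

(** * Additive characters of the prime field *)

Section Exponential.
Variable R : realType.
Implicit Types x y : R.
Local Notation e := (@e_ R).

Lemma e_D x y : e (x + y) = e x * e y.
Proof.
rewrite /e_ mulrDr cosD sinD; apply/eqP; rewrite eq_complex /=.
by rewrite eqxx /= [X in _ == X]addrC eqxx.
Qed.

Lemma e_0 : e 0 = 1.
Proof. by rewrite /e_ mulr0 cos0 sin0. Qed.

Lemma e_1 : e 1 = 1.
Proof. by rewrite /e_ mulr1 mulr_natl cos2pi sin2pi. Qed.

Lemma e_conj x : (e x)^* = e (- x).
Proof. by rewrite /e_ mulrN cosN sinN. Qed.

Lemma e_natM (m : nat) x : e (m%:R * x) = e x ^+ m.
Proof.
elim: m => [|m IH]; first by rewrite mul0r e_0.
by rewrite -natr1 mulrDl mul1r e_D IH exprSr.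
Qed.

Lemma e_intM_eq1 (m : int) x : e x = 1 -> e (m%:~R * x) = 1.
Proof.
case: m => m ex; first by rewrite -pmulrn e_natM ex expr1n.
by rewrite NegzE mulrNz mulNr -e_conj -pmulrn e_natM ex expr1n rmorph1.
Qed.

(** The real part alone decides: cos(2 pi x) = 1 would force sin(pi x) = 0, yet that sine is
    positive. *)
Lemma e_neq1 x : 0 < x < 1 -> e x != 1.
Proof.
case/andP=> x0 x1; apply/eqP => -[] + _.
have -> : 2 * pi * x = (pi * x) *+ 2 by rewrite -mulrA mulr_natl.
rewrite cos_mulr2n => c1.
have s0 : 0 < sin (pi * x).
  by rewrite sin_gt0_pi // mulr_gt0 ?pi_gt0 //= gtr_pMr ?pi_gt0.
have := cos2Dsin2 (pi * x).
have : cos (pi * x) ^+ 2 = 1 by lra.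
move=> -> h; have : 0 < sin (pi * x) ^+ 2 by rewrite exprn_gt0.
lra.
Qed.

Lemma e_prim_root (n : nat) : (0 < n)%N -> n.-primitive_root (e n%:R^-1).
Proof.
move=> n0; have nR : (0 : R) < n%:R by rewrite ltr0n.
rewrite /primitive_root_of_unity n0; apply/forallP => i.
rewrite unity_rootE -e_natM; apply/eqP.
have [in1|in1] := eqVneq i.+1 n; first by rewrite in1 divff ?e_1 ?eqxx ?pnatr_eq0 -?lt0n.
apply/negbTE/e_neq1; rewrite divr_gt0 ?ltr0n //= ltr_pdivrMr // mul1r ltr_nat.
by rewrite ltn_neqAle in1 ltn_ord.
Qed.

Lemma normc_real (x : R) : `|x%:C| = `|x|%:C.
Proof. by rewrite normc_def /= expr0n addr0 sqrtr_sqr. Qed.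

End Exponential.

Section PrimeField.
Variables (p : nat).
Hypothesis p_pr : prime p.

Lemma Fp_natr (x : 'F_p) : (val x)%:R = x.
Proof. exact: natr_Zp. Qed.

Lemma Fp_natr_eq0 m : ((m%:R : 'F_p) == 0) = ~~ coprime m p.
Proof.
rewrite coprime_sym prime_coprime // negbK -val_eqE /= val_Fp_nat //.
Qed.

Lemma Fp_natr_eq m k : ((m%:R : 'F_p) == k%:R) = (m == k %[mod p]).
Proof. by rewrite -val_eqE /= !val_Fp_nat. Qed.

Lemma sum_Fp (V : nmodType) (h : 'F_p -> V) :
  \sum_(1 <= a < p.+1) h a%:R = \sum_x h x.
Proof.
(* The range runs from 1 to [p], with [p] standing for 0, so the field variable is shifted by
   one. *)
have -> : \sum_x h x = \sum_x h (1 + x) by rewrite (reindex_inj (addrI 1)).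
transitivity (\sum_(x < (Zp_trunc (pdiv p)).+2) h (1 + (val x)%:R)); last first.
  by apply: eq_bigr => x _; rewrite Fp_natr.
rewrite -(big_mkord xpredT (fun a => h (1 + a%:R))) Fp_cast // big_add1.
by apply: eq_bigr => a _; rewrite -nat1r.
Qed.

Variables (R : realType) (n : int).
Hypothesis n_p : coprimez n p.
Definition add_char (x : 'F_p) : R[i] := e_ (n%:~R * (val x)%:R / p%:R).

Let pR : (p%:R : R) != 0.
Proof. by rewrite pnatr_eq0 -lt0n prime_gt0. Qed.

Lemma add_char_nat m : add_char m%:R = e_ (n%:~R * m%:R / p%:R).
Proof.
rewrite /add_char /= val_Fp_nat // {2}(divn_eq m p) natrD natrM.
have -> : n%:~R * ((m %/ p)%:R * p%:R + (m %% p)%:R) / p%:R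
   = (m %/ p)%:R * (n%:~R * 1) + n%:~R * (m %% p)%:R / p%:R :> R by field.
by rewrite e_D e_natM e_intM_eq1 ?e_1 // expr1n mul1r.
Qed.

Lemma add_charD x y : add_char (x + y) = add_char x * add_char y.
Proof.
rewrite -(Fp_natr x) -(Fp_natr y) -natrD !add_char_nat -e_D natrD.
by congr e_; field.
Qed.

Lemma add_char0 : add_char 0 = 1.
Proof. by rewrite (add_char_nat 0) mulr0 mul0r e_0. Qed.

(** The representative of [- x] is not the opposite of that of [x]; instead, both sides are inverse
    to [add_char x]. *)
Lemma add_char_conj x : (add_char x)^* = add_char (- x).
Proof.
have := add_charD x (- x); rewrite subrr add_char0.
have := e_D (n%:~R * (val x)%:R / p%:R) (- (n%:~R * (val x)%:R / p%:R) : R).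
rewrite subrr e_0 -e_conj -/(add_char x) => h1 h2.
apply: (@mulfI _ (add_char x)); last by rewrite -h1 -h2.
by apply/eqP => h0; move/eqP: h1; rewrite h0 mul0r oner_eq0.
Qed.

(** A Bezout relation writes 1/p as an integer multiple of n/p plus an integer, so triviality at 1
    would make e(1/p) equal to 1. *)
Lemma add_char1 : add_char 1 != 1.
Proof.
rewrite (add_char_nat 1) mulr1; apply/eqP => h.
have := n_p; rewrite coprimezE => /coprimezP[[u v] /= uv].
have : e_ (p%:R^-1 : R) != 1.
  by rewrite e_neq1 // invr_gt0 ltr0n prime_gt0 //= invf_lt1 ?ltr0n ?ltr1n ?prime_gt0 ?prime_gt1.
have -> : p%:R^-1 = u%:~R * (n%:~R / p%:R) + v%:~R * 1 :> R.
  have := congr1 (fun z : int => (z%:~R : R) / p%:R) uv.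
  by rewrite intrD !intrM -!pmulrn mulrDl (mulfK pR) mul1r mulrA mulr1 => ->.
by rewrite e_D (e_intM_eq1 _ h) (e_intM_eq1 _ (e_1 R)) mulr1 eqxx.
Qed.

Lemma sum_add_char : \sum_x add_char x = 0.
Proof. exact: (sum_eigen_eq0 (addrI 1) add_char1 (add_charD 1)). Qed.

End PrimeField.

(** * Dirichlet characters modulo a prime *)

Section DirichletCharacters.
Variables (R : realType) (p : nat).
Hypotheses (p_pr : prime p).
Variables (g : 'F_p) (zeta : R[i]).
Hypotheses (gP : (#|'F_p|.-1).-primitive_root g) (zetaP : (#|'F_p|.-1).-primitive_root zeta).
Local Notation N := (#|'F_p|.-1).

Definition dchar (k : nat) (a : nat) : R[i] := ff_char g zeta k (a%:R : 'F_p).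

Lemma dchar_dirichlet k : is_dirichlet_char p (dchar k).
Proof.
split; rewrite /dchar.
- by move=> a; rewrite -Fp_nat_mod // modnDr Fp_nat_mod.
- by move=> a b; rewrite natrM (ff_charM gP zetaP).
- exact: ff_char1 gP zetaP k.
- by move=> a; rewrite (ff_char_eq0 gP zetaP) Fp_natr_eq0.
Qed.

Lemma dchar_inj (k l : 'I_N) : dchar k = dchar l -> k = l.
Proof.
move/(congr1 (fun chi => chi (val g))); rewrite /dchar Fp_natr.
rewrite -(expr1 g) !(ff_char_gX gP zetaP) !mul1n => /eqP.
rewrite (eq_prim_root_expr zetaP) !modn_small // => /eqP; exact: val_inj.
Qed.

(** A character is determined by its value at the generator, and that value is a root of unity of
    order dividing [N], hence a power of [zeta]. *)
Lemma dirichlet_dchar chi : is_dirichlet_char p chi -> exists k : 'I_N, chi = dchar k.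
Proof.
case=> chi_per chiM chi1 chi_eq0.
have chi_mul a m : chi (a + m * p)%N = chi a.
  by elim: m => [|m IH]; rewrite ?addn0 // mulSn addnCA addnC chi_per.
have chi_mod a b : a = b %[mod p] -> chi a = chi b.
  by move=> ab; rewrite (divn_eq a p) (divn_eq b p) ab ![(_ * _ + _)%N]addnC !chi_mul.
have chiX a m : chi (a ^ m)%N = chi a ^+ m.
  by elim: m => [|m IH]; rewrite ?expn0 // expnS chiM IH exprS.
have gX m : (val g ^ m)%:R = g ^+ m by rewrite natrX Fp_natr.
have [|k gk] := prim_rootP zetaP (x := chi (val g)).
  rewrite -chiX -chi1; apply: chi_mod; apply/eqP; rewrite -Fp_natr_eq // gX.
  by rewrite (prim_expr_order gP).
exists k; apply/funext => a; rewrite /dchar.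
have [a0|a0] := eqVneq (a%:R : 'F_p) 0.
  by rewrite a0 ff_char0; apply/eqP; rewrite chi_eq0 -Fp_natr_eq0 // a0.
have [m am] := finField_prim_rootP gP a0.
rewrite am (ff_char_gX gP zetaP) mulnC exprM -gk -chiX; apply: chi_mod.
by apply/eqP; rewrite -Fp_natr_eq // gX am.
Qed.

(** The set of characters is an injective image of a finite range, which turns the sum over a set
    into an ordinary indexed one. *)
Lemma sum_dirichlet_chars (h : (nat -> R[i]) -> R[i]) :
  \sum_(chi \in @dirichlet_chars R p) h chi = \sum_(k < N) h (dchar k).
Proof.
have -> : @dirichlet_chars R p = [set dchar k | k in `I_N]%classic.
  apply/seteqP; split=> chi /=.
    by case/dirichlet_dchar => k ->; exists (val k) => //=.
  by case=> k _ <-; exact: dchar_dirichlet.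
rewrite fsbig_image; first by rewrite -(fsbig_ord _ _ (fun k => h (dchar k))).
move=> k l /set_mem /= kN /set_mem /= lN.
by move/(@dchar_inj (Ordinal kN) (Ordinal lN)) => [].
Qed.

Lemma gauss_gen_dchar n k : coprimez n p ->
  gauss_gen n (dchar k) p = gauss (fun=> ff_char g zeta k) (@add_char p R n) tt.
Proof.
move=> n_p; rewrite /gauss_gen /gauss.
rewrite -(sum_Fp p_pr (fun x => ff_char g zeta k x * add_char R n (x ^+ 2))).
by apply: eq_bigr => a _; rewrite -!natrX add_char_nat.
Qed.

End DirichletCharacters.

(** * The explicit moment and its error term *)

Lemma sixth_moment_formula (R : realType) (p : nat) (n : int) :
  prime p -> odd p -> coprimez n p ->
  exists2 theta : R[i], theta ^+ 2 = (@quad 'F_p (-1))%:~R * p%:R &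
  let S := - 1 - (@quad 'F_p (-1))%:~R in
  sixth_moment R n p =
  theta ^+ 3 * ((p%:R - 1) * (@quad 'F_p (-1))%:~R * (triple_sum 'F_p)%:~R)
  + 6 * p%:R ^+ 2 * (p%:R - 1) * (p%:R - 3) + 4 * p%:R ^+ 3 * (p%:R - 1)
  + (theta * S + p%:R + 1) ^+ 3 - (theta * S + 2 * p%:R) ^+ 3.
Proof.
move=> p_pr p_odd n_p.
have char2 : (2 : 'F_p) != 0.
  by rewrite (Fp_natr_eq0 p_pr 2) negbK coprime2n.
have [g gP] := finField_prim_root 'F_p.
have N0 : (0 < #|'F_p|.-1)%N by exact: prim_order_gt0 gP.
pose zeta : R[i] := e_ (#|'F_p|.-1)%:R^-1.
have zetaP : (#|'F_p|.-1).-primitive_root zeta by exact: e_prim_root.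
pose chi (k : 'I_(#|'F_p|.-1)) := ff_char g zeta k.
pose i0 : 'I_(#|'F_p|.-1) := Ordinal N0.
pose psi := @add_char p R n.
have qp : (#|'F_p|%:R : R[i]) = p%:R by rewrite card_Fp.
have chi0 i : chi i 0 = 0 by exact: ff_char0.
have chiM i x y : chi i (x * y) = chi i x * chi i y by exact: ff_charM.
have chi1 i : chi i 1 = 1 by exact: ff_char1.
have sum_psi : \sum_x psi x = 0 by exact: sum_add_char.
have psi0 : psi 0 = 1 by exact: add_char0.
have psiD x y : psi (x + y) = psi x * psi y by exact: add_charD.
have psi_conj x : (psi x)^* = psi (- x) by exact: add_char_conj.
have chi_conj i x : (chi i x)^* = chi i x^-1 by exact: ff_char_conj.
have chi_trivial x : chi i0 x = (x != 0)%:R by exact: ff_char_trivial.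
have sum_index x : \sum_i chi i x = if x == 1 then #|'F_p|%:R - 1 else 0.
  exact: sum_ff_char_index.
have sum_chi i : \sum_x chi i x = if i == i0 then #|'F_p|%:R - 1 else 0.
  by rewrite sum_ff_char // -val_eqE.
exists (gauss_quad psi); first by rewrite gauss_quad_sqr // qp.
rewrite /sixth_moment (sum_dirichlet_chars p_pr gP zetaP) /=.
rewrite -(shift_sum_trivial char2 chi_trivial chi0) -qp.
rewrite -(sum_gauss_norm6 char2 chiM chi1 chi_conj chi_trivial sum_index
  sum_chi chi0 psiD psi0 psi_conj sum_psi).
by apply: eq_bigr => k _; rewrite gauss_gen_dchar.
Qed.

(** Reducing by [t ^+ 2 = q] cancels the fourth powers of q and leaves [t * X + Y]. The constant 100
    is 44 from [X] plus 56 for [Y], the latter absorbed using [1 <= s]. *)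
Lemma moment_error_bound (R : realType) (q t T s : R) :
  1 <= q -> 0 <= s -> s ^+ 2 = q -> `|t| = s -> `|T| <= 8 * q ->
  `|t ^+ 3 * ((q - 1) * T) + 6 * q ^+ 2 * (q - 1) * (q - 3) + 4 * q ^+ 3 * (q - 1)
    + (q + 1 - 2 * t) ^+ 3 - (2 * q - 2 * t) ^+ 3 - 10 * q ^+ 4|
  <= 100 * q ^+ 3 * s.
Proof.
move=> q1 s0 sq ts T8.
have tq : t ^+ 2 = q by rewrite -sq -ts real_normK ?num_real.
have s1 : 1 <= s by rewrite -(@ler_pXn2r _ 2) ?nnegrE // expr1n sq.
pose X := q * (q - 1) * T + 18 * q ^+ 2 - 12 * q - 6.
pose Y := - 35 * q ^+ 3 + 9 * q ^+ 2 + 15 * q + 1.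
have -> : t ^+ 3 * ((q - 1) * T) + 6 * q ^+ 2 * (q - 1) * (q - 3) + 4 * q ^+ 3 * (q - 1)
    + (q + 1 - 2 * t) ^+ 3 - (2 * q - 2 * t) ^+ 3 - 10 * q ^+ 4 = t * X + Y.
  by rewrite /X /Y -tq; ring.
have q12 : q <= q ^+ 2 by rewrite expr2; nra.
have q23 : q ^+ 2 <= q ^+ 3 by rewrite exprSr; nra.
have XB : `|X| <= 44 * q ^+ 3.
  have : `|q * (q - 1) * T| <= q ^+ 2 * (8 * q).
    rewrite normrM ler_pM // ger0_norm; nra.
  have -> : q ^+ 2 * (8 * q) = 8 * q ^+ 3 by ring.
  by rewrite /X !ler_norml => /andP[h1 h2]; apply/andP; split; lra.
have YB : `|Y| <= 56 * q ^+ 3.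
  by rewrite /Y ler_norml; apply/andP; split; lra.
rewrite (le_trans (ler_normD _ _)) // normrM ts.
have : s * `|X| <= s * (44 * q ^+ 3) by rewrite ler_wpM2l.
have : 56 * q ^+ 3 <= 56 * q ^+ 3 * s by rewrite ler_peMr //; lra.
have : s * (44 * q ^+ 3) = 44 * q ^+ 3 * s by ring.
by lra.
Qed.

Theorem theorem6 (R : realType) :
  exists C : R, forall (p : nat) (n : int),
    prime p -> odd p -> coprimez n (Posz p) ->
    ((p %% 4 = 1)%N ->
       `|sixth_moment R n p - 10 * (p%:R : R[i]) ^+ 4|
         <= (C * (p%:R : R) ^+ 3 * Num.sqrt (p%:R : R))%:C) /\
    ((p %% 4 = 3)%N ->
       sixth_moment R n p =
         ((p%:R : R[i]) - 1) * (10 * (p%:R) ^+ 3 - 25 * (p%:R) ^+ 2 - 4 * p%:R - 1)).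
Proof.
exists 100 => p n p_pr p_odd n_p.
have char2 : (2 : 'F_p) != 0.
  by rewrite (Fp_natr_eq0 p_pr 2) negbK coprime2n.
have [theta theta2 /= ->] := sixth_moment_formula R p_pr p_odd n_p.
split=> p4.
- have N1 : @quad 'F_p (-1) = 1 by rewrite quadN1_mod4_1 ?card_Fp.
  pose q : R := p%:R; pose s := Num.sqrt q.
  have q0 : 0 <= q by rewrite ler0n.
  have s2 : s ^+ 2 = q by rewrite sqr_sqrtr.
  have qC : (p%:R : R[i]) = q%:C by rewrite rmorph_nat.
  (* Here [theta] is real with an undetermined sign, which is harmless because the bound uses only
     its absolute value. *)
  have [t tE ts] : exists2 t : R, theta = t%:C & `|t| = s.
    have : theta ^+ 2 == (s%:C) ^+ 2.
      by rewrite theta2 N1 mul1r -rmorphXn /= s2 qC.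
    rewrite eqf_sqr => /orP[]/eqP->; [exists s|exists (- s)] => //.
    + by rewrite ger0_norm ?sqrtr_ge0.
    + by rewrite rmorphN.
    + by rewrite normrN ger0_norm ?sqrtr_ge0.
  have T8 : `|(triple_sum 'F_p)%:~R : R| <= 8 * q.
    have := triple_sum_bound char2 N1; rewrite card_Fp // => h.
    by rewrite -intr_norm (le_trans (y := (8 * p%:Z)%:~R)) ?ler_int // intrM.
  have q1 : 1 <= q by rewrite ler1n prime_gt0.
  have := moment_error_bound q1 (sqrtr_ge0 q) s2 ts T8.
  rewrite -lecR -normc_real; congr (`|_| <= _).
  have TC : ((triple_sum 'F_p)%:~R : R[i]) = ((triple_sum 'F_p)%:~R : R)%:C.
    by rewrite rmorph_int.
  rewrite N1 tE qC TC.
  rewrite !(rmorphD, rmorphB, rmorphM, rmorphXn, rmorph1, rmorph_nat) /=.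
  by ring.
- have N1 : @quad 'F_p (-1) = -1 by rewrite quadN1_mod4_3 ?card_Fp.
  (* Both the triple sum and [- 1 - quad (-1)] vanish, so [theta] drops out and a polynomial
     identity in p remains. *)
  rewrite triple_sum_eq0 // N1.
  by ring.
Qed.
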